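(* For every $m \in \mathbb{N}$ and every list $l$ of natural numbers that is sorted in non-increasing order and whose elements are all $\le m$, there exists $x \in \mathbb{N}$ such that $\mathrm{lgen}_m(x) = l$.
   Context: Lists of natural numbers: $[\,]$ is the empty list, $h :: t$ the list with head $h$ and tail $t$. For $m \in \mathbb{N}$, $\mathrm{next}_m$ is defined recursively by: $\mathrm{next}_m([\,]) = [0]$; $\mathrm{next}_m(h :: t) = (h+1) :: t$ if $h < m$; and if $h \ge m$: $\mathrm{next}_m(h :: t) = [\,]$ when $\mathrm{next}_m(t) = [\,]$, and $\mathrm{next}_m(h :: t) = x :: x :: t'$ when $\mathrm{next}_m(t) = x :: t'$. The function $\mathrm{lgen}_m : \mathbb{N} \to$ lists is defined by $\mathrm{lgen}_m(0) = [\,]$ and $\mathrm{lgen}_m(x+1) = \mathrm{next}_m(\mathrm{lgen}_m(x))$. *)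

(* Defs.v *)
From mathcomp Require Import all_boot.

Set Implicit Arguments.
Unset Strict Implicit.
Unset Printing Implicit Defensive.

(* The branch [lnext m t = [::]] never occurs. *)
Fixpoint lnext (m : nat) (l : seq nat) : seq nat :=
  match l with
  | [::] => [:: 0]
  | h :: t =>
      if h < m then h.+1 :: t
      else match lnext m t with
           | [::] => [::]
           | x :: t' => [:: x, x & t']
           end
  end.

Fixpoint lgen (m x : nat) : seq nat :=
  match x with
  | 0 => [::]
  | x'.+1 => lnext m (lgen m x')
  end.

(* Main.v *)
(* The sequence lgen counts, at fixed length, with the last entry as the most
   significant digit.  Hence [head 0 t :: t] climbs in its first entry to [m :: t],
   and then carries over to [head 0 t' :: t'] with [t' = lnext m t].  So if [t] is
   generated then so is [head 0 t :: t], and therefore every [h :: t] with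
   [head 0 t <= h <= m]; induct on the list. *)
Require Import Defs.
From mathcomp Require Import all_boot.

Lemma lnext_consE (m : nat) (l : seq nat) :
  lnext m l = head 0 (lnext m l) :: behead (lnext m l).
Proof.
elim: l => [//|h t IHt] /=; case: ifP => // _.
by rewrite IHt.
Qed.

(** An increment happens only below [m], and a carry copies the head of [lnext m t]. *)
Lemma head_lnext_leq (m : nat) (l : seq nat) : head 0 (lnext m l) <= m.
Proof.
elim: l => [//|h t IHt] /=; case: ifP => // _.
by rewrite lnext_consE.
Qed.

Lemma head_lgen_leq (m x : nat) : head 0 (lgen m x) <= m.
Proof. by case: x => [//|x]; apply: head_lnext_leq. Qed.

Lemma lnext_carry (m : nat) (t : seq nat) :
  lnext m (m :: t) = head 0 (lnext m t) :: lnext m t.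
Proof. by rewrite /= ltnn lnext_consE. Qed.

(** While the head is below [m], a step only increments it, so [h - a] further steps suffice. *)
Lemma lgen_raise_head (m a h x : nat) (t : seq nat) :
  a <= h <= m -> lgen m x = a :: t -> exists y, lgen m y = h :: t.
Proof.
case/andP=> /subnKC <-; elim: (h - a) => [|k IHk] le_m gen_x.
  by exists x; rewrite addn0.
rewrite addnS in le_m *.
have [y gen_y] := IHk (ltnW le_m) gen_x.
by exists y.+1; rewrite /= gen_y /= le_m.
Qed.

Lemma lgen_dup_head (m x : nat) :
  exists y, lgen m y = head 0 (lgen m x) :: lgen m x.
Proof.
(* [lgen m 1] is [[:: 0]], whose entry matches the default head of [[::]]. *)
elim: x => [|x [y gen_y]]; first by exists 1.
have [|z gen_z] := @lgen_raise_head m _ m _ _ _ gen_y.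
  by rewrite head_lgen_leq leqnn.
by exists z.+1; rewrite [LHS]/= gen_z lnext_carry.
Qed.

Theorem theorem7 (m : nat) (l : seq nat)
    (hsorted : sorted geq l) (hbound : all (fun h => h <= m) l) :
  exists x : nat, lgen m x = l.
Proof.
elim: l hsorted hbound => [|h t IHt] sorted_ht /=; first by exists 0.
case/andP=> le_hm le_tm.
have [x gen_t] := IHt (path_sorted sorted_ht) le_tm.
have [y] := lgen_dup_head m x; rewrite gen_t; apply: lgen_raise_head.
(* For empty [t] the default head [0] is at most [h]; otherwise sortedness gives the bound. *)
by rewrite le_hm andbT; case: t sorted_ht {IHt le_tm gen_t} => //= a t /andP[].
Qed.
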